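(* Let $f\colon M\to M$ be a homeomorphism of a compact manifold $M$ of dimension $n$. The following statements are equivalent: (1) $f$ is partially expansive with central dimension $D=n-1$; (2) $f$ is sensitive to initial conditions.
   Context: $M$ is regarded as a compact metric space with metric $\operatorname{dist}$ inducing its topology. A set is non-trivial if it has more than one point. Given an integer $D\geq -1$, a homeomorphism $f\colon X\to X$ of a compact metric space $(X,\operatorname{dist})$ is partially expansive with central dimension $D$ and expansive constant $\epsilon>0$ if for every non-trivial compact set $C\subset X$ with $\dim(C)>D$ there is $k\in\mathbb{Z}$ such that $\operatorname{diam}(f^k(C))\geq\epsilon$; it is partially expansive with central dimension $D$ if this holds for some $\epsilon>0$. Here $\dim$ is the topological (covering) dimension. A homeomorphism $f\colon X\to X$ is sensitive to initial conditions if there is $\rho>0$ such that for all $x\in X$ and for all $r>0$ there are $y\in B_r(x)$ and $k\in\mathbb{Z}$ (positive or negative) such that $\operatorname{dist}(f^k(y),f^k(x))>\rho$, where $B_r(x)$ is the ball of radius $r$ centered at $x$.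
   Formalization: The dimension n of the manifold is assumed to be at least 1; for n = 0 the claim fails, since a one-point manifold is vacuously partially expansive with D = -1 but is not sensitive to initial conditions. *)

(* Defs.v *)
From HB Require Import structures.
From mathcomp Require Import all_boot all_order all_algebra.
From mathcomp Require Import all_classical all_reals all_analysis.

Set Implicit Arguments.
Unset Strict Implicit.
Unset Printing Implicit Defensive.

Import Order.TTheory GRing.Theory Num.Theory.
Import numFieldNormedType.Exports.

Local Open Scope classical_set_scope.
Local Open Scope ring_scope.

Definition homeomorphic_sets (S T : topologicalType) (A : set S) (B : set T) :=
  exists (phi : S -> T) (psi : T -> S),
    [/\ set_fun A B phi, {within A, continuous phi} &
        {in A, cancel phi psi}] /\
    [/\ set_fun B A psi, {within B, continuous psi} &
        {in B, cancel psi phi}].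

(* Topological manifold without boundary. The Hausdorff and second countability
   axioms are not repeated: they hold in every compact metric space, the only
   case in which this definition is used. *)
Definition locally_euclidean (R : realType) (n : nat) (M : topologicalType) :=
  forall x : M, exists (U : set M) (V : set 'rV[R]_n),
    [/\ open U, U x, open V & homeomorphic_sets U V].

(* Covering dimension of the subspace C of T: every finite open cover has a
   finite open refinement of order at most d, i.e. no point lies in more than
   d + 1 members. Relatively open subsets of C are represented by open subsets
   of T of which they are the traces, so covering, refinement and order are
   only tested on C. In particular, the dimension is at most -1 iff C is
   empty. *)
Definition covering_dim_le (T : topologicalType) (C : set T) (d : int) :=
  forall (m : nat) (U : 'I_m -> set T),
    (forall i, open (U i)) -> C `<=` \bigcup_i U i ->
    exists (p : nat) (V : 'I_p -> set T),
      [/\ forall j, open (V j),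
          C `<=` \bigcup_j V j,
          forall j, exists i, C `&` V j `<=` U i &
          forall x, C x -> (#|[pred j | `[< V j x >]]|%:Z <= d + 1)%R].

(* The dimension is infinite when it is bounded by no d. *)
Definition covering_dim_gt (T : topologicalType) (C : set T) (d : int) :=
  ~ covering_dim_le C d.

Definition nontrivial_set (T : Type) (C : set T) :=
  exists x y, [/\ C x, C y & x <> y].

(* Meaningful for nonempty bounded sets. *)
Definition diam (R : realType) (X : metricType R) (C : set X) : R :=
  sup [set mdist p.1 p.2 | p in C `*` C].

Record homeo (X : topologicalType) := Homeo {
  homeo_fun :> X -> X;
  homeo_inv : X -> X;
  homeo_funK : cancel homeo_fun homeo_inv;
  homeo_invK : cancel homeo_inv homeo_fun;
  homeo_fun_continuous : continuous homeo_fun;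
  homeo_inv_continuous : continuous homeo_inv }.

Definition homeo_iter (X : topologicalType) (f : homeo X) (k : int) : X -> X :=
  match k with
  | Posz m => iter m (homeo_fun f)
  | Negz m => iter m.+1 (homeo_inv f)
  end.

Definition partially_expansive_with (R : realType) (X : metricType R)
    (f : homeo X) (D : int) (eps : R) :=
  forall C : set X, compact C -> nontrivial_set C -> covering_dim_gt C D ->
    exists k : int, eps <= diam (homeo_iter f k @` C).

Definition partially_expansive (R : realType) (X : metricType R)
    (f : homeo X) (D : int) :=
  exists2 eps : R, 0 < eps & partially_expansive_with f D eps.

Definition sensitive (R : realType) (X : metricType R) (f : homeo X) :=
  exists2 rho : R, 0 < rho &
    forall (x : X) (r : R), 0 < r ->
      exists (y : X) (k : int),
        ball x r y /\ rho < mdist (homeo_iter f k y) (homeo_iter f k x).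

(* Main.v *)
Require Import Defs.
From HB Require Import structures.
From mathcomp Require Import all_boot all_order all_algebra.
From mathcomp Require Import all_classical all_reals all_analysis.
From mathcomp Require Import ring lra.

(** The equivalence rests on the fact that the compact subsets of dimension n of
    an n-manifold are those with nonempty interior; more precisely, on two facts
    about the covering dimension.

    Every ball contains a nontrivial compact set of dimension greater than n - 1,
    the image of a cube in a chart ([full_dim_compact_in_ball]). If f is not
    sensitive, some ball has all its iterates of diameter as small as wanted, and
    so has this compact set, which contradicts partial expansivity. The dimension
    of the cube is Lebesgue's covering theorem ([cube_dim_gt]). It follows from
    the Poincare-Miranda theorem on common zeros, which is reduced to a statement
    on the grid {0, ..., N}^n: if the i-th of n functions with values in Z/2 is 0
    where z i = 0 and 1 where z i = N, then all of them vary on a common unit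
    cube. Indeed the cup product of their coboundaries has an odd sum over the
    grid, by a discrete Stokes formula and induction on n ([boxsum_cup]).

    Conversely, a compact set of empty interior has dimension at most n - 1
    ([nowhere_dense_dim_le]). So a compact set C of dimension greater than n - 1
    contains a ball, and sensitivity at the center of this ball yields an iterate
    of C of diameter greater than rho. The dimension is local on compact sets,
    thanks to the sum theorem for two closed sets ([covering_dim_leU]), so that it
    suffices to consider a compact set of empty interior in R^n. A fine grid can
    be translated so that its points avoid this set, and it is only near these
    points that the usual cover of R^n by neighborhoods of the faces of the grid,
    sorted by dimension, has order n + 1 ([covering_dim_le_nowhere_dense]). *)

Set Implicit Arguments.
Unset Strict Implicit.
Unset Printing Implicit Defensive.
Import Order.TTheory GRing.Theory Num.Theory.
Import numFieldNormedType.Exports.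
Local Open Scope ring_scope.

(** * A discrete Poincare-Miranda theorem *)

Section DiscretePoincareMiranda.
Variable I : finType.
Implicit Types (z : I -> nat) (i j : I) (S : {set I}) (L : seq I).
Local Notation cochain := ((I -> nat) -> 'F_2).

Lemma addrr_F2 (x : 'F_2) : x + x = 0.
Proof. by apply: addrr_pchar2; apply: pchar_Fp. Qed.

Definition step z i : I -> nat := fun j => (z j + (j == i))%N.

Definition upd z i t : I -> nat := fun j => if j == i then t else z j.

Lemma stepC z i j : step (step z i) j = step (step z j) i.
Proof. by apply: funext => k; rewrite /step addnAC. Qed.

Lemma step_upd z i t : step (upd z i t) i = upd z i t.+1.
Proof.
by apply: funext => k; rewrite /step /upd; case: eqP; rewrite ?addn0 ?addn1.
Qed.

Lemma updC z i j s t : i != j -> upd (upd z i s) j t = upd (upd z j t) i s.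
Proof.
move=> ij; apply: funext => k; rewrite /upd.
by have [->|//] := eqVneq k j; rewrite eq_sym (negbTE ij).
Qed.

Lemma upd_step z i j t : i != j -> upd (step z i) j t = step (upd z j t) i.
Proof.
move=> ij; apply: funext => k; rewrite /upd /step.
by have [->|//] := eqVneq k j; rewrite eq_sym (negbTE ij) addn0.
Qed.

Lemma exchange_off_diagonal S (g : I -> I -> 'F_2) :
  \sum_(i in S) \sum_(j in S :\ i) g i j = \sum_(j in S) \sum_(i in S :\ j) g i j.
Proof.
rewrite (exchange_big_dep (mem S)) /=; last by move=> i j _ /finset.setD1P[].
apply: eq_bigr => j jS; apply: eq_bigl => i.
by rewrite !inE jS andbT andbC eq_sym.
Qed.

(** Modulo 2 the terms at (i, j) and (j, i) cancel: working modulo 2 avoids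
    following the orientations of the simplices. *)
Lemma sum_off_diagonal_sym S (g : I -> I -> 'F_2) :
  (forall i j, g i j = g j i) -> \sum_(i in S) \sum_(j in S :\ i) g i j = 0.
Proof.
move=> gC; pose lt i j := (enum_rank i < enum_rank j)%N.
have split_lt : \sum_(i in S) \sum_(j in S :\ i) g i j =
    \sum_(i in S) \sum_(j in S | lt i j) g i j +
    \sum_(i in S) \sum_(j in S | lt j i) g i j.
  rewrite -big_split /=; apply: eq_bigr => i iS.
  rewrite (bigID (lt i)) /=; congr (_ + _); apply: eq_bigl => j; rewrite !inE /lt.
    by have [->|//] := eqVneq j i; rewrite ltnn !andbF.
  rewrite -leqNgt leq_eqVlt; have [->|ji] := eqVneq j i; first by rewrite ltnn andbF.
  by rewrite (inj_eq val_inj) (inj_eq enum_rank_inj) (negbTE ji).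
rewrite split_lt [X in _ + X](exchange_big_dep (mem S)) /=; last first.
  by move=> i j _ /andP[].
rewrite -[RHS](addrr_F2 (\sum_(i in S) \sum_(j in S | lt i j) g i j)).
congr (_ + _); apply: eq_bigr => i iS; apply: eq_big => [j|j _]; last exact: gC.
by rewrite iS.
Qed.

(** When fs has as many members as S, [cup fs S z] is the cup product of the
    coboundaries of the functions fs, evaluated on the sum of the simplices that
    triangulate the unit cube with lowest vertex z and directions S: each of
    these simplices is a path from z that takes one unit step in every direction
    of S, and its k-th step contributes the variation of the k-th function. The
    recursion on the first step avoids an explicit sum over permutations. *)
Fixpoint cup (fs : seq cochain) S z : 'F_2 :=
  if fs is f :: fs' then
    \sum_(i in S) (f (step z i) + f z) * cup fs' (S :\ i) (step z i)
  else (S == finset.set0)%:R.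

(** A product of coboundaries is a cocycle: its sum over the boundary of a cube
    vanishes, opposite faces being [step z i] and z. In the expansion along the
    first function f, the terms where f is taken after two steps cancel by
    symmetry, and the others reduce to the faces of the cube, by induction. *)
Lemma cup_closed fs S z :
  \sum_(i in S) cup fs (S :\ i) (step z i) = \sum_(i in S) cup fs (S :\ i) z.
Proof.
elim: fs S z => [//|f fs IH] S z /=.
pose A i j := cup fs (S :\ i :\ j).
have AC i j : A i j = A j i by rewrite /A !finset.setDDl finset.setUC.
have IHA i w : \sum_(j in S :\ i) A i j (step w j) = \sum_(j in S :\ i) A i j w.
  exact: IH.
transitivity (\sum_(i in S) \sum_(j in S :\ i) f (step z i) * A i j (step z i)).
  under eq_bigr do under eq_bigr do rewrite mulrDl.
  under eq_bigr do rewrite big_split /=.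
  rewrite big_split /= [X in X + _]sum_off_diagonal_sym ?add0r; last first.
    by move=> i j; rewrite stepC -/(A i j) -/(A j i) AC.
  by apply: eq_bigr => i _; rewrite -!mulr_sumr IHA.
under [RHS]eq_bigr do under eq_bigr do rewrite mulrDl.
under [RHS]eq_bigr do rewrite big_split /=.
rewrite [RHS]big_split /= [X in _ = _ + X](_ : _ = 0) ?addr0; last first.
  under eq_bigr do rewrite -mulr_sumr IHA.
  by rewrite -mulr_sumr sum_off_diagonal_sym ?mulr0 // => i j; rewrite AC.
rewrite [RHS]exchange_off_diagonal.
by apply: eq_bigr => i _; apply: eq_bigr => j _; rewrite AC.
Qed.

Lemma cup_neq0 fs S z : cup fs S z != 0 -> forall f, f \in fs ->
  exists p q, [/\ forall j, (z j <= p j <= z j + (j \in S))%N,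
    forall j, (z j <= q j <= z j + (j \in S))%N & f p != f q].
Proof.
elim: fs S z => [//|g fs IH] S z /= nz f.
have [i /andP[iS]] : exists i, (i \in S) &&
    ((g (step z i) + g z) * cup fs (S :\ i) (step z i) != 0).
  apply/existsP; apply: contraR nz => /existsPn all0.
  by apply/eqP/big1 => i iS; have /nandP[/negP//|/negPn/eqP] := all0 i.
rewrite mulf_eq0 negb_or => /andP[g_ne cup_ne]; rewrite inE => /predU1P[->|f_fs].
  exists (step z i), z; split=> [j|j|].
  - by rewrite /step leq_addr leq_add2l; have [->|] := eqVneq j i; rewrite ?iS.
  - by rewrite leqnn leq_addr.
  - by apply: contraNneq g_ne => ->; rewrite addrr_F2.
have sub w : (forall j, (step z i j <= w j <= step z i j + (j \in S :\ i))%N) ->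
    forall j, (z j <= w j <= z j + (j \in S))%N.
  move=> wP j; have /andP[lo hi] := wP j; rewrite /step in lo hi.
  rewrite (leq_trans (leq_addr _ _) lo) (leq_trans hi) // -addnA leq_add2l !inE.
  by have [->|] := eqVneq j i; rewrite ?iS.
by have [p [q [/sub Hp /sub Hq ne]]] := IH _ _ cup_ne f f_fs; exists p, q.
Qed.

(** If f is constant on the hyperplane through z orthogonal to the direction i,
    no path from z that stays in this hyperplane sees f vary. *)
Lemma cup_eq0 fs S z i (f : cochain) : f \in fs -> i \notin S ->
  (forall w j, w i = z i -> j != i -> f (step w j) = f w) -> cup fs S z = 0.
Proof.
elim: fs S z => [//|g fs IH] S z /=; rewrite inE => /predU1P[<-|f_fs] iS const.
  apply: big1 => j jS; rewrite const ?addrr_F2 ?mul0r //.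
  by apply: contraNneq iS => <-.
apply: big1 => j jS; have ji : j != i by apply: contraNneq iS => <-.
have szi : step z j i = z i by rewrite /step eq_sym (negbTE ji) addn0.
rewrite [cup _ _ _]IH ?mulr0 // => [|w k wi]; first by rewrite !inE negb_and iS orbT.
by apply: const; rewrite wi.
Qed.

Fixpoint boxsum N L (G : cochain) z : 'F_2 :=
  if L is i :: L' then \sum_(t < N) boxsum N L' G (upd z i t) else G z.

Lemma boxsum_big N L (J : finType) (P : pred J) (G : J -> cochain) z :
  boxsum N L (fun w => \sum_(i | P i) G i w) z = \sum_(i | P i) boxsum N L (G i) z.
Proof.
by elim: L z => //= k L IH z; rewrite exchange_big /=; apply: eq_bigr => t _.
Qed.

Lemma boxsum0 N L z : boxsum N L (fun=> 0) z = 0.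
Proof. by elim: L z => //= k L IH z; apply: big1 => t _. Qed.

Lemma boxsumD N L (G H : cochain) z :
  boxsum N L (fun w => G w + H w) z = boxsum N L G z + boxsum N L H z.
Proof.
by elim: L z => //= k L IH z; rewrite -big_split; apply: eq_bigr => t _.
Qed.

Lemma eq_boxsum N L i (G H : cochain) z : i \notin L ->
  (forall w, w i = z i -> G w = H w) -> boxsum N L G z = boxsum N L H z.
Proof.
elim: L z => /= [|k L IH] z; first by move=> _ ->.
rewrite inE negb_or => /andP[ik iL] GH; apply: eq_bigr => t _.
by apply: IH => // w; rewrite {1}/upd (negbTE ik); apply: GH.
Qed.

Lemma boxsum_neq0 N L (G : cochain) z : boxsum N L G z != 0 ->
  exists w, G w != 0 /\ forall i, (w i < N)%N || (i \notin L) && (w i == z i).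
Proof.
elim: L z => /= [|k L IH] z nz.
  by exists z; rewrite nz; split=> // i; rewrite eqxx orbT.
have [t /IH[w [Gw wP]]] : exists t : 'I_N, boxsum N L G (upd z k t) != 0.
  apply/existsP; apply: contraR nz => /existsPn all0.
  by apply/eqP/big1 => i _; apply/eqP/negPn/all0.
exists w; split=> // i; have := wP i; rewrite inE /upd negb_or.
have [->|//] := eqVneq i k; case: ltnP => //= le /andP[_ /eqP wt].
by rewrite wt leqNgt ltn_ord in le.
Qed.

Lemma boxsum_step N L i G z : i \notin L ->
  boxsum N L (fun w => G (step w i)) z = boxsum N L G (step z i).
Proof.
elim: L z => //= k L IH z; rewrite inE negb_or => /andP[ik iL].
by apply: eq_bigr => t _; rewrite IH // upd_step.
Qed.

Lemma telescope_F2 N (F : nat -> 'F_2) :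
  \sum_(t < N) (F t.+1 + F t) = F N + F 0%N.
Proof.
elim: N => [|N IH]; first by rewrite big_ord0 addrr_F2.
by rewrite big_ord_recr /= IH addrC -addrA (addrA (F N)) addrr_F2 add0r.
Qed.

(** Along the direction i only the two opposite faces of the box remain. *)
Lemma boxsum_telescope N L i G z : uniq L -> i \in L ->
  boxsum N L (fun w => G (step w i) + G w) z =
  boxsum N (rem i L) G (upd z i N) + boxsum N (rem i L) G (upd z i 0%N).
Proof.
elim: L z => //= k L IH z /andP[kL uL]; have [<- _|ki] := eqVneq k i.
  under eq_bigr do rewrite boxsumD boxsum_step // step_upd.
  exact: (telescope_F2 N (fun t => boxsum N L G (upd z k t))).
rewrite inE eq_sym (negbTE ki) /= => iL; rewrite -big_split /=.
by apply: eq_bigr => t _; rewrite IH // !(updC _ _ _ ki).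
Qed.

(** Discrete Stokes formula. With f the first function and w the product of the
    coboundaries of the others, the integrand is the coboundary of f * w, as w
    is closed. So its sum over the box is a sum over the faces. On the two faces
    orthogonal to another direction j, the function of index j is constant and
    w vanishes; on the two faces orthogonal to the first direction, f is 0 and
    1 respectively. What remains is the same sum in one dimension less. *)
Lemma boxsum_cup N (f : I -> cochain) :
  (forall i z, z i = 0%N -> f i z = 0) -> (forall i z, z i = N -> f i z = 1) ->
  forall L z, uniq L -> boxsum N L (cup (map f L) [set i in L]) z = 1.
Proof.
move=> f0 fN; elim=> [|i L IH] z /=.
  have /eqP-> : [set j in [::]] == finset.set0 :> {set I}.
    by apply/eqP/finset.setP => j; rewrite !inE.
  by rewrite eqxx.
move=> /andP[iL uL]; set S := [set j in i :: L]; set fs := map f L.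
pose G j w := f i w * cup fs (S :\ j) w.
have cupE w : cup (f i :: fs) S w = \sum_(j in S) (G j (step w j) + G j w).
  rewrite /= /G big_split /=; under eq_bigr do rewrite mulrDl.
  by rewrite big_split /= -!mulr_sumr cup_closed.
transitivity (boxsum N (i :: L) (fun w => \sum_(j in S) (G j (step w j) + G j w)) z).
  by congr (boxsum N (i :: L) _ z); apply: funext => w; apply: cupE.
have iS : i \in S by rewrite !inE eqxx.
rewrite boxsum_big (bigD1 i iS) big1 ?Monoid.mulm1 => [|j /andP[jS ji]].
  rewrite boxsum_telescope ?mem_head //= ?iL // eqxx.
  have z0 : boxsum N L (G i) (upd z i 0%N) = boxsum N L (fun=> 0) (upd z i 0%N).
    by apply: (eq_boxsum _ iL) => w wi; rewrite /G f0 ?mul0r // wi /upd eqxx.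
  have zN : boxsum N L (G i) (upd z i N) = boxsum N L (cup fs [set j in L]) (upd z i N).
    apply: (eq_boxsum _ iL) => w wi; rewrite /G fN ?mul1r; last by rewrite wi /upd eqxx.
    congr cup; apply/finset.setP => j; rewrite !inE.
    by have [->|] := eqVneq j i; rewrite ?(negbTE iL).
  by rewrite z0 zN IH // boxsum0 addr0.
have jL : j \in i :: L by rewrite -[j \in _]finset.in_set; exact: jS.
have uiL : uniq (i :: L) by rewrite /= iL.
rewrite boxsum_telescope //.
have jrem : j \notin rem j (i :: L) by rewrite mem_rem_uniqF.
have face t c : (forall w, w j = t -> f j w = c) ->
    boxsum N (rem j (i :: L)) (G j) (upd z j t) = 0.
  move=> const; rewrite -(boxsum0 N (rem j (i :: L)) (upd z j t)).
  apply: (eq_boxsum _ jrem) => w.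
  rewrite {1}/upd eqxx => wj.
  have fj : f j \in fs by apply: map_f; rewrite in_cons (negbTE ji) in jL.
  rewrite /G (@cup_eq0 _ _ _ j (f j)) ?mulr0 ?inE ?eqxx // => v k vj kj.
  by rewrite !const // ?vj // /step eq_sym (negbTE kj) addn0 vj.
by rewrite (face N 1) 1?(face 0%N 0) ?addr0 //; auto; move=> w wj; auto.
Qed.

(** The sum of the cup product over all unit cubes is odd, so it is nonzero on
    one of them, where therefore every function varies. *)
Theorem discrete_poincare_miranda N (b : I -> (I -> nat) -> bool) :
  (forall i z, z i = 0%N -> ~~ b i z) -> (forall i z, z i = N -> b i z) ->
  exists z, (forall i, z i < N)%N /\ forall i, exists p q,
    [/\ forall j, (z j <= p j <= (z j).+1)%N,
        forall j, (z j <= q j <= (z j).+1)%N, b i p & ~~ b i q].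
Proof.
move=> b0 bN; pose f i z : 'F_2 := (b i z)%:R.
have f0 i z : z i = 0%N -> f i z = 0 by rewrite /f => /b0/negbTE->.
have fN i z : z i = N -> f i z = 1 by rewrite /f => /bN->.
have [] := @boxsum_neq0 N (enum I) (cup (map f (enum I)) [set i in enum I]) (fun=> 0%N).
  by rewrite boxsum_cup ?enum_uniq.
move=> z [cup_ne zN]; exists z; split=> i; first by have := zN i; rewrite mem_enum orbF.
have [p [q [pP qP fpq]]] := cup_neq0 cup_ne (map_f f (mem_enum I i)).
have near w : (forall j, (z j <= w j <= z j + (j \in [set i in enum I]))%N) ->
    forall j, (z j <= w j <= (z j).+1)%N.
  by move=> wP j; have := wP j; rewrite inE mem_enum addn1.
case bp: (b i p); case bq: (b i q).
- by move: fpq; rewrite /f bp bq eqxx.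
- by exists p, q; rewrite bp bq; split; first exact: near; first exact: near.
- by exists q, p; rewrite bp bq; split; first exact: near; first exact: near.
- by move: fpq; rewrite /f bp bq eqxx.
Qed.

End DiscretePoincareMiranda.

Local Open Scope classical_set_scope.

(** * The Poincare-Miranda theorem *)

Lemma lebesgue_number (R : realType) (T : pseudoMetricType R) (J : Type)
    (C : set T) (U : J -> set T) :
  compact C -> (forall j, open (U j)) -> C `<=` \bigcup_j U j ->
  exists2 e : R, 0 < e & forall x, C x -> exists j, ball x e `<=` U j.
Proof.
move=> /compact_near_coveringP Ccpt Uopen CU.
have : \forall e \near 0^'+, C `<=` [set x | exists j, ball x e `<=` U j].
  apply: Ccpt => x /CU[j _ Ujx].
  have /nbhs_ballP[e /= e0 xeU] : nbhs x (U j) by apply: open_nbhs_nbhs.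
  exists (ball x (e / 2), [set d | d < e / 2]) => /=.
    split; first by apply: nbhsx_ballx; rewrite divr_gt0.
    by apply: nbhs_right_lt; rewrite divr_gt0.
  move=> [y d] /= [xy de]; exists j => w yw; apply: xeU.
  rewrite (splitr e); apply: ball_triangle xy _.
  exact: le_ball (ltW de) _ yw.
move=> lebC; near (0 : R)^'+ => e; exists e; first by near: e; exact: nbhs_right_gt.
by move=> x Cx; apply: (near lebC e).
Unshelve. all: by end_near. Qed.

Section Cubes.
Context {R : realType} {n : nat}.
Implicit Types (c x y : 'rV[R]_n) (e : R).

Definition cube c e := [set x : 'rV[R]_n | forall i, `|x 0 i - c 0 i| <= e].

Lemma rV_ballP x y e : 0 < e -> (ball x e y <-> forall i, `|x 0 i - y 0 i| < e).
Proof.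
move=> e0; split=> [[_ xy] i|xy]; first exact: xy.
by split=> // i j; rewrite (ord1 i); apply: xy.
Qed.

Lemma cube_compact c e : compact (cube c e).
Proof.
have -> : cube c e = [set x : 'rV[R]_n |
    forall i, `[c 0 i - e, c 0 i + e]%classic (x ord0 i)].
  by apply/seteqP; split=> x /= xP i; have := xP i; rewrite in_itv /= ler_distl.
apply: (@rV_compact _ _ (fun i => `[c 0 i - e, c 0 i + e]%classic)) => i.
exact: segment_compact.
Qed.

(** Without a common zero, the open sets where some F i has a strict sign cover
    the cube. In a grid finer than a Lebesgue number of this cover, every small
    cube lies in one of them, whereas the discrete theorem, applied to the signs
    of the F i at the grid points, gives a small cube on which no F i has a
    strict constant sign. *)
Theorem poincare_miranda c e (F : 'I_n -> 'rV[R]_n -> R) :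
  0 < e -> (forall i, continuous (F i)) ->
  (forall i x, cube c e x -> x 0 i = c 0 i - e -> 0 <= F i x) ->
  (forall i x, cube c e x -> x 0 i = c 0 i + e -> F i x <= 0) ->
  exists2 x, cube c e x & forall i, F i x = 0.
Proof.
move=> e0 Fc Flo Fhi; apply/not_exists2P => noz.
pose U (k : 'I_n * bool) := [set x | if k.2 then 0 < F k.1 x else F k.1 x < 0].
have Uopen k : open (U k).
  case: k => i [].
  - exact: (open_comp (fun x _ => Fc i x) (@open_gt R 0)).
  - exact: (open_comp (fun x _ => Fc i x) (@open_lt R 0)).
have cubeU : cube c e `<=` \bigcup_k U k.
  move=> x cx; have [//|/existsNP[i /eqP Fx]] := noz x.
  exists (i, 0 < F i x) => //; rewrite /U /=.
  by have [//|//|/eqP] := ltgtP (F i x) 0; rewrite (negbTE Fx).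
have [d d0 leb] := lebesgue_number (cube_compact (c := c) (e := e)) Uopen cubeU.
pose N := (Num.truncn (2 * e / d)).+1.
have N0 : (0 : R) < N%:R by rewrite ltr0n.
have Nd : 2 * e / N%:R < d.
  by rewrite ltr_pdivrMr // [d * _]mulrC -ltr_pdivrMr //; exact: truncnS_gt.
pose g (z : 'I_n -> nat) : 'rV[R]_n := \row_i (c 0 i - e + (z i)%:R * (2 * e / N%:R)).
have gE z i : g z 0 i = c 0 i - e + (z i)%:R * (2 * e / N%:R) by rewrite mxE.
have h0 : 0 < 2 * e / N%:R by rewrite divr_gt0 // mulr_gt0.
have g_cube z : (forall i, (z i <= N)%N) -> cube c e (g z).
  move=> zN i; rewrite gE.
  have : (z i)%:R * (2 * e / N%:R) <= 2 * e.
    by rewrite mulrCA ger_pMr ?mulr_gt0 // ler_pdivrMr // mul1r ler_nat.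
  have : 0 <= (z i)%:R * (2 * e / N%:R) by rewrite mulr_ge0 // ltW.
  rewrite ler_norml; lra.
(* The sign of F i at a grid point; where the weak boundary inequalities leave
   it undetermined, on the faces z i = 0 and z i = N, it is prescribed. *)
pose b i z := (z i == N) || (z i != 0)%N && (F i (g z) < 0).
have b0 i z : z i = 0%N -> ~~ b i z by rewrite /b => ->.
have bN i z : z i = N -> b i z by rewrite /b => ->; rewrite eqxx.
have [z [zN zP]] := discrete_poincare_miranda b0 bN.
have near_le w : (forall i, (z i <= w i <= (z i).+1)%N) -> forall i, (w i <= N)%N.
  by move=> wz i; have /andP[_ /leq_trans->] := wz i.
have near_ball w : (forall i, (z i <= w i <= (z i).+1)%N) -> ball (g z) d (g w).
  move=> wz; apply/rV_ballP => // i; rewrite !gE; have /andP[lo hi] := wz i.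
  rewrite distrC (_ : _ - _ = (w i - z i)%:R * (2 * e / N%:R)); last first.
    by rewrite natrB //; ring.
  rewrite normrM normr_nat gtr0_norm // (le_lt_trans _ Nd) // ger_pMl //.
  by rewrite lern1 leq_subLR addn1.
have [[i s] ballU] := leb (g z) (g_cube z (fun i => ltnW (zN i))).
have [p [q [pz qz bp bq]]] := zP i.
have Fp : F i (g p) <= 0.
  case/orP: bp => [/eqP pN|/andP[_ /ltW//]]; apply: Fhi; first exact/g_cube/near_le.
  by rewrite gE pN mulrC divfK ?gt_eqF //; lra.
have Fq : 0 <= F i (g q).
  move: bq; rewrite /b negb_or negb_and negbK -leNgt => /andP[_ /orP[/eqP q0|//]].
  by apply: Flo; [exact/g_cube/near_le|rewrite gE q0 mul0r addr0].
have := ballU _ (near_ball _ pz); have := ballU _ (near_ball _ qz).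
by rewrite /U /=; case: s {ballU} => ? ?; lra.
Qed.

End Cubes.

(** * Covering dimension *)

Definition order_le (T : Type) (J : finType) (C : set T) (V : J -> set T) (d : int) :=
  forall x, C x -> (#|[pred j | `[< V j x >]]|%:Z <= d + 1).

Lemma order_le_sub (T : Type) (J : finType) (C : set T) (V W : J -> set T) d :
  (forall j, C `&` W j `<=` V j) -> order_le C V d -> order_le C W d.
Proof.
move=> WV Vd x Cx; apply: le_trans (Vd x Cx); rewrite lez_nat.
apply/subset_leq_card/fintype.subsetP => j; rewrite !inE => Wj.
exact: WV (conj Cx Wj).
Qed.

Section CoveringDimension.
Variable T : topologicalType.
Implicit Types (A B C : set T) (d : int).

(** A refinement can be indexed like the cover itself: unite the members of the
    refinement that were assigned to the same member of the cover. *)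
Lemma covering_dim_le_shrink C d (J : finType) (U : J -> set T) :
  covering_dim_le C d -> (forall j, open (U j)) -> C `<=` \bigcup_j U j ->
  exists V : J -> set T, [/\ forall j, open (V j), forall j, V j `<=` U j,
    C `<=` \bigcup_j V j & order_le C V d].
Proof.
move=> Cd Uopen CU; have [||p [V [Vopen CV VU Vd]]] := Cd #|J| (U \o enum_val).
- by move=> i; exact: Uopen.
- by move=> x /CU[j _ Ujx]; exists (enum_rank j) => //=; rewrite enum_rankK.
have [h hP] := choice VU.
exists (fun j => U j `&` \bigcup_(k in [set k | enum_val (h k) = j]) V k); split.
- by move=> j; apply: openI => //; apply: bigcup_open => k _.
- by move=> j x [].
- move=> x Cx; have [k _ Vkx] := CV x Cx.
  by exists (enum_val (h k)) => //; split; [exact: hP | exists k].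
- move=> x Cx; apply: le_trans (Vd x Cx); rewrite lez_nat.
  apply: leq_trans (leq_image_card (enum_val \o h) _).
  apply/subset_leq_card/fintype.subsetP => j; rewrite inE => -[_ [k /= <- Vkx]].
  by apply: (fintype.image_f (enum_val \o h)); rewrite inE.
Qed.

Lemma covering_dim_le0 d : covering_dim_le (@set0 T) d.
Proof.
move=> m U _ _; exists 0%N, (fun=> set0); split=> // [j|j]; first exact: open0.
by case: j.
Qed.

(** A cover of a larger set can be shrunk so as to have small order on a closed
    subset A alone: use a shrinking along A, and keep the cover off A, which is
    open. *)
Lemma shrink_on_closed A d (J : finType) (U : J -> set T) :
  closed A -> covering_dim_le A d -> (forall j, open (U j)) ->
  A `<=` \bigcup_j U j ->
  exists W : J -> set T, [/\ forall j, open (W j), forall j, W j `<=` U j,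
    \bigcup_j U j `<=` \bigcup_j W j & order_le A W d].
Proof.
move=> Acl Ad Uopen AU.
have [V [Vopen VU AV Vd]] := covering_dim_le_shrink Ad Uopen AU.
exists (fun j => V j `|` (U j `&` ~` A)); split.
- by move=> j; apply: openU => //; apply: openI => //; exact: closed_openC.
- by move=> j x [/VU|[]].
- move=> x [j _ Ujx]; have [/AV[k _ Vkx]|nAx] := pselect (A x).
    by exists k => //; left.
  by exists j => //; right.
- by apply: order_le_sub Vd => j x [Ax [//|[_ /(_ Ax)]]].
Qed.

(** Shrink first along A, then along B; the second shrinking cannot increase the
    order on A. *)
Lemma covering_dim_leU A B d : closed A -> closed B ->
  covering_dim_le A d -> covering_dim_le B d -> covering_dim_le (A `|` B) d.
Proof.
move=> Acl Bcl Ad Bd m U Uopen ABU.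
have [|V [Vopen VU UV VA]] := shrink_on_closed Acl Ad Uopen.
  by move=> x Ax; apply: ABU; left.
have [|W [Wopen WV VW WB]] := shrink_on_closed Bcl Bd Vopen.
  by move=> x Bx; apply/UV/ABU; right.
exists m, W; split=> [//||j|x].
- by move=> x /ABU/UV/VW.
- by exists j => x [_ /WV/VU].
- by case; [apply: order_le_sub VA _ => j y [_ /WV] | exact: WB].
Qed.

(** The closed sets B such that C `&` B has dimension at most d are stable under
    finite unions. If C were not one of them, the sets C `\` B would form a
    filter base; its cluster point in the compact set C would have a neighborhood
    B of this kind, which C `\` B misses. *)
Lemma covering_dim_le_local C d : compact C -> closed C ->
  (forall x, C x ->
    exists B, [/\ closed B, nbhs x B & covering_dim_le (C `&` B) d]) ->
  covering_dim_le C d.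
Proof.
move=> Ccpt Ccl Cloc; apply: contrapT => nCd.
pose good := [set B | closed B /\ covering_dim_le (C `&` B) d].
pose F := filter_from good (fun B => C `\` B).
have good0 : good set0.
  by split; [exact: closed0 | rewrite setI0; exact: covering_dim_le0].
have FF : ProperFilter F.
  apply: filter_from_proper; last first.
    move=> B [Bcl Bd]; apply/set0P/eqP => CB; apply: nCd.
    by have -> : C = C `&` B by apply/esym/setIidl; rewrite -setD_eq0.
  apply: filter_from_filter.
    by exists set0.
  move=> A B [Acl Ad] [Bcl Bd]; exists (A `|` B); last by rewrite setDUr.
  split; first exact: closedU.
  by rewrite setIUr; apply: covering_dim_leU => //; exact: closedI.
have FC : F C.
  by exists set0 => // x [].
have [x [Cx xF]] := Ccpt F FF FC; have [B [Bcl xB Bd]] := Cloc x Cx.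
have FB : F (C `\` B) by exists B.
by have [y [[_ nBy] By]] := xF _ _ FB xB.
Qed.

End CoveringDimension.

Lemma covering_dim_le_image (S T : topologicalType) (U A : set S) (V : set T)
    (phi : S -> T) (psi : T -> S) (d : int) :
  open U -> open V -> set_fun U V phi ->
  {within U, continuous phi} -> {within V, continuous psi} ->
  {in U, cancel phi psi} -> A `<=` U ->
  covering_dim_le A d -> covering_dim_le (phi @` A) d.
Proof.
move=> Uo Vo UV phic psic phiK AU Ad m Y Yo AY.
have phiI X : open X -> open (U `&` phi @^-1` X).
  by move: X; apply/(continuous_inP _ Uo); rewrite -continuous_open_subspace.
have psiI X : open X -> open (V `&` psi @^-1` X).
  by move: X; apply/(continuous_inP _ Vo); rewrite -continuous_open_subspace.
have phiKA a : A a -> psi (phi a) = a by move=> /AU Ua; apply: phiK; rewrite inE.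
have [||p [W [Wo AW WY Wd]]] := Ad m (fun i => U `&` phi @^-1` Y i).
- by move=> i; exact: phiI.
- move=> a Aa; have [|i _ Yi] := AY (phi a); first by exists a.
  by exists i => //; split => //; exact: AU.
exists p, (fun j => V `&` psi @^-1` W j); split.
- by move=> j; exact: psiI.
- move=> _ [a Aa <-]; have [j _ Wja] := AW a Aa; exists j => //.
  by split; [exact/UV/AU | rewrite /= phiKA].
- move=> j; have [i WYi] := WY j; exists i => _ [[a Aa <-] [_ /=]].
  by rewrite phiKA // => Wja; have [] := WYi a (conj Aa Wja).
- move=> _ [a Aa <-]; apply: le_trans (Wd a Aa); rewrite lez_nat.
  apply/subset_leq_card/fintype.subsetP => j; rewrite !inE => -[_ /=].
  by rewrite phiKA.
Qed.

Section DistanceToComplement.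
Context {R : realType} {V : normedModType R}.
Variable U : set V.

(** The radius 1 keeps the set nonempty when U is the whole space. *)
Let radii x : set R := [set r | r = 1 \/ exists2 y, ~ U y & r = `|x - y|].

Definition dist_out x : R := inf (radii x).

Let radii_ge0 x : lbound (radii x) 0.
Proof. by move=> r [->|[y _ ->]]. Qed.

Lemma dist_out_ge0 x : 0 <= dist_out x.
Proof. by apply: lb_le_inf; [exists 1; left | exact: radii_ge0]. Qed.

Lemma dist_out_eq0 x : ~ U x -> dist_out x = 0.
Proof.
move=> nUx; apply/eqP; rewrite eq_le dist_out_ge0 andbT.
apply: ge_inf; first by exists 0; exact: radii_ge0.
by right; exists x => //; rewrite subrr normr0.
Qed.

Lemma dist_out_gt0 x : open U -> U x -> 0 < dist_out x.
Proof.
move=> Uo Ux; have /nbhs_ballP[e /= e0 xeU] : nbhs x U by exact: open_nbhs_nbhs.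
apply: (@lt_le_trans _ _ (Num.min 1 e)); first by rewrite lt_min ltr01.
apply: lb_le_inf; first by exists 1; left.
move=> r [->|[y nUy ->]]; rewrite ge_min ?lexx // orbC leNgt; apply/orP; left.
by apply/negP => xy; apply/nUy/xeU; rewrite -ball_normE.
Qed.

Let dist_out_lip x y : dist_out x <= dist_out y + `|x - y|.
Proof.
rewrite -lerBlDr; apply: lb_le_inf; first by exists 1; left.
have xlb : has_lbound (radii x) by exists 0; exact: radii_ge0.
move=> r [->|[z nUz ->]]; rewrite lerBlDr.
  apply: (@le_trans _ _ 1); last by rewrite lerDl.
  by apply: ge_inf => //; left.
apply: (@le_trans _ _ `|x - z|); first by apply: ge_inf => //; right; exists z.
by rewrite [leRHS]addrC -(subrKA y) ler_normD.
Qed.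

Lemma dist_out_continuous : continuous dist_out.
Proof.
move=> x; apply/cvgrPdist_le => e e0; near=> y.
apply: (@le_trans _ _ `|x - y|).
  have := dist_out_lip x y; have := dist_out_lip y x; rewrite distrC.
  by rewrite ler_norml; lra.
by near: y; apply: cvgr_dist_le.
Unshelve. all: by end_near. Qed.

End DistanceToComplement.

(** * Lebesgue's covering theorem *)

Lemma open_forall (T : topologicalType) (J : finType) (A : J -> set T) :
  (forall j, open (A j)) -> open [set x | forall j, A j x].
Proof.
move=> Ao; rewrite openE => x Ax; apply: filter_forall => j.
exact: open_nbhs_nbhs.
Qed.

Section LebesgueCovering.
Context {R : realType} {n : nat}.
Implicit Types (c x : 'rV[R]_n) (e : R).

Lemma coord_open (A : set R) (i : 'I_n) :
  open A -> open [set x : 'rV[R]_n | A (x 0 i)].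
Proof.
move=> Ao; apply: (@open_comp _ _ (fun x : 'rV[R]_n => x 0 i)) => // x _.
exact: coord_continuous.
Qed.

(** Lebesgue's covering theorem. The cover consists of n + 1 sets: U k avoids the
    lower faces of index less than k and, for k < n, the upper face of index k.
    A shrinking W of order at most n would leave no point common to all of its
    members. But the differences of the truncated distances to the complements of W i and
    W (i + 1) satisfy the boundary conditions of the Poincare-Miranda theorem; at
    a common zero these distances are all equal, and positive because W covers
    the cube. *)
Theorem cube_dim_gt c e : 0 < e -> covering_dim_gt (cube c e) (n%:Z - 1).
Proof.
move=> e0 dimQ.
pose lower i := [set x : 'rV[R]_n | x 0 i < c 0 i + e].
pose upper i := [set x : 'rV[R]_n | c 0 i - e < x 0 i].
pose slab (k : 'I_n.+1) (i : 'I_n) :=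
  if (i < k)%N then upper i else if i == k :> nat then lower i else setT.
pose U k := [set x | forall i, slab k i x].
have Uopen k : open (U k).
  apply: open_forall => i; rewrite /slab; case: ifP => _.
    exact: coord_open (@open_gt _ _).
  case: ifP => _; last exact: openT.
  exact: coord_open (@open_lt _ _).
have QU : cube c e `<=` \bigcup_k U k.
  move=> x Qx.
  pose low k := [exists i : 'I_n, (i == k :> nat) && (x 0 i == c 0 i - e)].
  have upperx (i : 'I_n) : ~~ low i -> upper i x.
    move=> /existsPn/(_ i); rewrite eqxx /= => xi.
    rewrite /upper /= lt_neqAle eq_sym xi /=.
    by have := Qx i; rewrite ler_norml; lra.
  have [[k lowk]|nolow] := pselect (exists k, low k); last first.
    exists ord_max => // i; rewrite /slab ltn_ord; apply: upperx.
    by apply/negP => ?; apply: nolow; exists i.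
  (* The first lower face that contains x tells which U k contains x. *)
  have := ex_minnP (ex_intro (fun k => low k) k lowk).
  case=> m /existsP[j /andP[/eqP jm /eqP xj]] mmin.
  exists (widen_ord (leqnSn n) j) => // i; rewrite /slab /=; case: ltnP => ij.
    by apply: upperx; apply/negP => /mmin; rewrite leqNgt -jm ij.
  by case: eqP => // /val_inj->; rewrite /lower /= xj; lra.
have [W [Wo WU QW Wd]] := covering_dim_le_shrink dimQ Uopen QU.
pose F (i : 'I_n) x :=
  dist_out (W (widen_ord (leqnSn n) i)) x - dist_out (W (lift ord0 i)) x.
have Fc i : continuous (F i).
  by move=> x; apply: (@continuousB R); exact: dist_out_continuous.
have [||x Qx Fx] := @poincare_miranda _ _ c _ _ e0 Fc.
- move=> i x _ xi; rewrite /F (@dist_out_eq0 _ _ (W (lift ord0 i))).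
    by rewrite subr0 dist_out_ge0.
  by move=> /WU/(_ i); rewrite /slab /= /bump /= add1n ltnSn /upper /= xi ltxx.
- move=> i x _ xi; rewrite /F (@dist_out_eq0 _ _ (W (widen_ord _ i))).
    by rewrite sub0r oppr_le0 dist_out_ge0.
  by move=> /WU/(_ i); rewrite /slab /= ltnn eqxx /lower /= xi ltxx.
have distE (j : 'I_n.+1) : dist_out (W j) x = dist_out (W ord0) x.
  have [k] := ubnP (val j); elim: k j => // k IH j; rewrite ltnS => jk.
  case: (unliftP ord0 j) jk => [i ->|-> //] jk.
  have := Fx i; rewrite /F => /subr0_eq <-; apply: IH.
  by move: jk; rewrite /= /bump leq0n add1n.
have [k _ Wkx] := QW x Qx.
have dist_gt0 : 0 < dist_out (W ord0) x by rewrite -(distE k) dist_out_gt0.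
have := Wd x Qx; rewrite subrK lez_nat leqNgt => /negP; apply.
rewrite -[leqLHS]card_ord; apply/subset_leq_card/fintype.subsetP => j _.
rewrite !inE.
apply: contrapT => nWj.
by rewrite -(distE j) dist_out_eq0 ?ltxx in dist_gt0.
Qed.

End LebesgueCovering.

(** * Compact sets with empty interior in Euclidean space *)

Lemma covering_dim_leI (T : topologicalType) (C : set T) (d : int) :
  (forall (m : nat) (U : 'I_m -> set T),
    (forall i, open (U i)) -> C `<=` \bigcup_i U i ->
    exists (J : finType) (V : J -> set T), [/\ forall j, open (V j),
      C `<=` \bigcup_j V j, forall j, exists i, C `&` V j `<=` U i &
      order_le C V d]) ->
  covering_dim_le C d.
Proof.
move=> Cd m U Uo CU; have [J [V [Vo CV VU Vd]]] := Cd m U Uo CU.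
exists #|J|, (V \o enum_val); split=> [j|x Cx|j|x Cx].
- exact: Vo.
- by have [j _ Vjx] := CV x Cx; exists (enum_rank j) => //=; rewrite enum_rankK.
- exact: VU.
- apply: le_trans (Vd x Cx).
  rewrite lez_nat -(fintype.card_image (@enum_val_inj J predT)).
  apply/subset_leq_card/fintype.subsetP => _ /fintype.imageP[j + ->].
  by rewrite !inE.
Qed.

Section GridCells.
Context {R : realType}.
Implicit Types (a h t x y : R) (z K : nat).

(** The line is decomposed along the grid a + h * nat at scale t: the near cell
    of index z surrounds a grid point, the far cell fills the gap between two
    consecutive near cells, up to the two points at distance t from the grid. *)
Definition cell (near : bool) a h t z : set R :=
  if near then [set x | `|x - (a + z%:R * h)| < t]
  else [set x | a + z%:R * h + t < x < a + z.+1%:R * h - t].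

Lemma open_cell near a h t z : open (cell near a h t z).
Proof.
case: near; rewrite /cell.
  rewrite (_ : [set _ | _] = ball (a + z%:R * h) t); first exact: ball_open.
  by apply/seteqP; split=> x; rewrite -ball_normE /= distrC.
rewrite (_ : [set _ | _] = `]a + z%:R * h + t, a + z.+1%:R * h - t[%classic).
  exact: itv_open.
by apply/seteqP; split=> x; rewrite /= in_itv.
Qed.

Lemma cell_diam near a h t z x y : t <= h / 2 -> 0 < t ->
  cell near a h t z x -> cell near a h t z y -> `|x - y| < h.
Proof.
rewrite /cell => ht t0; case: near => /=; rewrite ?ltr_norml; first by lra.
by rewrite -natr1 mulrDl mul1r; lra.
Qed.

Lemma near_far_disjoint a h t z w x : 0 < h ->
  cell true a h t z x -> cell false a h t w x -> False.
Proof.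
rewrite /cell /= ltr_norml => h0 /andP[zx xz] /andP[wx xw].
have /lt_geF : w%:R * h < z%:R * h by lra.
have : z%:R * h < w.+1%:R * h by lra.
by rewrite !ltr_pM2r // ler_pM2r // ltr_nat ler_nat ltnS => ->.
Qed.

Lemma cell_inj near a h t z w x : 0 < t -> t <= h / 2 ->
  cell near a h t z x -> cell near a h t w x -> z = w.
Proof.
move=> t0 th; have h0 : 0 < h by lra.
suff le z' w' : cell near a h t z' x -> cell near a h t w' x -> (z' <= w')%N.
  by move=> zx wx; apply/eqP; rewrite eqn_leq !le.
case: near; rewrite /cell /= ?ltr_norml => /andP[zx xz] /andP[wx xw].
  have : z'%:R * h < w'.+1%:R * h by rewrite -natr1 mulrDl mul1r; lra.
  by rewrite ltr_pM2r // ltr_nat.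
have : z'%:R * h < w'.+1%:R * h by lra.
by rewrite ltr_pM2r // ltr_nat.
Qed.

Lemma cell_cover a h t K x : 0 < h -> 0 < t -> a < x < a + K%:R * h ->
  (forall z : 'I_K.+1, ~~ (`|x - (a + z%:R * h)| <= t)) ->
  exists z : 'I_K.+1, cell false a h t z x.
Proof.
move=> h0 t0 /andP[ax xK] far.
have q0 : 0 <= (x - a) / h by rewrite divr_ge0 // ?ltW //; lra.
pose z := Num.truncn ((x - a) / h).
have zx : a + z%:R * h <= x.
  have : z%:R <= (x - a) / h by rewrite truncn_le.
  by rewrite ler_pdivlMr //; lra.
have xz : x < a + z.+1%:R * h.
  have : (x - a) / h < z.+1%:R by exact: truncnS_gt.
  by rewrite ltr_pdivrMr //; lra.
have zK : (z < K)%N by rewrite -(ltr_nat R) -(ltr_pM2r h0); lra.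
have zK1 : (z < K.+1)%N by rewrite ltnS ltnW.
have := far (Ordinal zK1); have := far (Ordinal (zK : (z.+1 < K.+1)%N)).
rewrite -!ltNge !ltr_normr /= => far1 far0; exists (Ordinal zK1).
rewrite /cell /=; apply/andP; split.
  by case/orP: far0; lra.
by case/orP: far1; lra.
Qed.

End GridCells.
Lemma dense_forall (T : topologicalType) (J : finType) (A : J -> set T) :
  (forall j, open (A j)) -> (forall j, dense (A j)) ->
  dense [set x | forall j, A j x].
Proof.
move=> Ao Ad; suff dense_seq (s : seq J) :
    dense [set x | forall j, j \in s -> A j x].
  move=> O O0 Oo; have [x [Ox Ax]] := dense_seq (enum J) O O0 Oo.
  by exists x; split=> // j; apply: Ax; rewrite mem_enum.
elim: s => [|k s IH].
  by move=> O [x Ox] _; exists x; split.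
have -> : [set x | forall j, j \in k :: s -> A j x] =
    A k `&` [set x | forall j, j \in s -> A j x].
  apply/seteqP; split=> x /=.
    by move=> Ax; split=> [|j js]; apply: Ax; rewrite inE ?eqxx ?js ?orbT.
  by move=> [Akx Ax] j; rewrite inE => /predU1P[->|/Ax].
exact: denseI.
Qed.

Lemma translate_continuous (R : realType) n (v : 'rV[R]_n) :
  continuous (fun a : 'rV[R]_n => a + v).
Proof.
move=> a; apply: (@cvgD _ _ _ (nbhs a) _ id (cst v)); first exact: cvg_id.
exact: cvg_cst.
Qed.

(** The condition defines a finite intersection of dense open sets of points
    a. *)
Lemma general_position (R : realType) n (C O : set 'rV[R]_n) (J : finType)
    (v : J -> 'rV[R]_n) :
  closed C -> C^° = set0 -> open O -> O !=set0 ->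
  exists2 a, O a & forall j, ~ C (a + v j).
Proof.
move=> Ccl C0 Oo O0; pose A j := [set a | ~ C (a + v j)].
have Ao j : open (A j).
  apply: (@open_comp _ _ (fun a : 'rV[R]_n => a + v j) (~` C)); last exact: closed_openC.
  by move=> a _; exact: translate_continuous.
have Ad j : dense (A j).
  move=> P [p Pp] Po; apply/set0P/eqP => PA.
  suff : C^° (p + v j) by rewrite C0.
  have : nbhs (p + v j) [set x : 'rV[R]_n | P (x - v j)].
    apply: open_nbhs_nbhs; split; last by rewrite /= addrK.
    apply: (@open_comp _ _ (fun a : 'rV[R]_n => a - v j) P) => // a _.
    exact: translate_continuous.
  apply: filterS => x /= Px; apply: contrapT => nCx.
  have : (P `&` A j) (x - v j) by split=> //; rewrite /A /= subrK.
  by rewrite PA.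
by have [a [Oa Aa]] := dense_forall Ao Ad O0 Oo; exists a.
Qed.

(** Translate a fine grid of R^(n+1) so that no grid point lies in C. Call a
    coordinate of x near at scale t if it is at distance less than t from the
    grid of that axis, and far if it is at distance more than t. For scales
    t 0 < ... < t n, take the small boxes in which a set of k <= n coordinates is
    near and the others far, at the scale t k. For a given k these boxes are
    pairwise disjoint, so that the order is at most n + 1. They cover C because
    the largest scale is so small that a point of C never has all its coordinates
    near. *)
Theorem covering_dim_le_nowhere_dense (R : realType) n (C : set 'rV[R]_n.+1) :
  compact C -> C^° = set0 -> covering_dim_le C (n.+1%:Z - 1).
Proof.
move=> Ccpt C0; have [->|/set0P[x0 Cx0]] := eqVneq C set0.
  exact: covering_dim_le0.
apply: covering_dim_leI => m U Uo CU.
have Ccl : closed C by apply: compact_closed => //; exact: norm_hausdorff.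
have [h h0 leb] := lebesgue_number Ccpt Uo CU.
have [B B0 CB] : exists2 B : R, 0 < B & forall x, C x -> forall i, `|x 0 i| < B.
  have [B [_ CB]] := compact_bounded Ccpt.
  exists (`|B| + 2) => [|x Cx i]; first by rewrite ltr_wpDl.
  have : `|x| <= `|B| + 1.
    by apply: CB Cx; rewrite (le_lt_trans (ler_norm B)) ?ltrDl.
  have : `|x 0 i| <= `|x|.
    rewrite [leRHS]/Num.norm /= mx_normrE.
    exact: (le_bigmax _ (fun k => `|x k.1 k.2|) (0, i)).
  lra.
pose K := (Num.truncn ((2 * B + h) / h)).+1.
have KB : 2 * B + h < K%:R * h.
  by rewrite -ltr_pdivrMr //; exact: truncnS_gt.
pose J := ({set 'I_n.+1} * {ffun 'I_n.+1 -> 'I_K.+1})%type.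
pose O := [set a : 'rV[R]_n.+1 | forall i,
  (`]- B - h, - B[%classic : set R) (a 0 i)].
have [||a Oa aC] := @general_position _ _ C O _
  (fun z : {ffun 'I_n.+1 -> 'I_K.+1} => \row_i ((z i)%:R * h)) Ccl C0.
- apply: open_forall => i.
  have Io : open (`]- B - h, - B[%classic : set R) by exact: itv_open.
  exact: (coord_open Io).
- by exists (\row_i (- B - h / 2)) => i; rewrite mxE /= in_itv /=; lra.
have aP i : - B - h < a 0 i < - B by have := Oa i; rewrite /= in_itv.
pose dst (x : 'rV[R]_n.+1) i (z : 'I_K.+1) : R := `|x 0 i - (a 0 i + z%:R * h)|.
(* A neighborhood of each of the finitely many grid points misses C. *)
have [s [s0 sh sC]] : exists s : R, [/\ 0 < s, s <= h / 2 &
    forall x, C x -> forall z : {ffun 'I_n.+1 -> 'I_K.+1},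
      exists i, s < dst x i (z i)].
  have near_s : \forall s \near 0^'+, forall z : {ffun 'I_n.+1 -> 'I_K.+1},
      forall x, C x -> exists i, s < dst x i (z i).
    apply: filter_forall => z; pose p := a + \row_i ((z i)%:R * h).
    have /nbhs_ballP[e /= e0 pe] : nbhs p (~` C).
      by apply: open_nbhs_nbhs; split; [exact: closed_openC | exact: aC].
    near=> s => x Cx; apply: contrapT => /forallNP close.
    apply: (pe x) => //; apply/rV_ballP => // i; rewrite distrC !mxE.
    have /negP := close i; rewrite -leNgt => /le_lt_trans; apply.
    by near: s; apply: nbhs_right_lt.
  near (0 : R)^'+ => s; exists s; split.
  - by near: s; exact: nbhs_right_gt.
  - by near: s; apply: nbhs_right_le; rewrite divr_gt0.
  - by move=> x Cx z; apply: (near near_s s) => //.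
(* The n + 1 scales increase up to t n = s. *)
pose t k : R := s * (k.+1%:R / n.+1%:R).
have t0 k : 0 < t k by rewrite mulr_gt0 // divr_gt0.
have t_lt k : t k < t k.+1 by rewrite ltr_pM2l // ltr_pM2r ?invr_gt0 // ltr_nat.
have t_le k : (k <= n)%N -> t k <= s.
  by move=> kn; rewrite ger_pMr // ler_pdivrMr // mul1r ler_nat.
have th k : (k <= n)%N -> t k <= h / 2 by move=> /t_le /le_trans; apply.
pose V (j : J) := [set x : 'rV[R]_n.+1 | (#|j.1| <= n)%N /\
  forall i, cell (i \in j.1) (a 0 i) h (t #|j.1|) (j.2 i) (x 0 i)].
have Vo j : open (V j).
  have -> : V j = (if (#|j.1| <= n)%N then
      [set x : 'rV[R]_n.+1 | forall i,
        cell (i \in j.1) (a 0 i) h (t #|j.1|) (j.2 i) (x 0 i)] else set0).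
    by rewrite /V; case: ifP => _; apply/seteqP; split=> x // [].
  case: ifP => _; last exact: open0.
  by apply: open_forall => i; apply: coord_open; exact: open_cell.
have Vinj x (j j' : J) : V j x -> V j' x -> #|j.1| = #|j'.1| -> j = j'.
  case: j j' => [A z] [A' z'] [/= An xz] [/= A'n xz'] AA'.
  rewrite -AA' in xz'.
  have memE i : (i \in A) = (i \in A').
    have := xz i; have := xz' i; case: (i \in A); case: (i \in A') => // c c'.
      by have := near_far_disjoint h0 c' c.
    by have := near_far_disjoint h0 c c'.
  have <- : A = A' by apply/setP.
  congr (_, _); apply/ffunP => i; apply: val_inj.
  by apply: (cell_inj (t0 _) (th _ An) (xz i)); have := xz' i; rewrite -memE.
exists J, V; split=> [//|x Cx|j|x Cx].
- pose N k : {set 'I_n.+1} := [set i | [exists z, dst x i z <= t k]]%SET.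
  have NS k : N k \subset N k.+1.
    apply/fintype.subsetP => i; rewrite !inE => /existsP[z xz]; apply/existsP; exists z.
    exact: le_trans xz (ltW (t_lt k)).
  have Nn : (#|N n| <= n)%N.
    rewrite -ltnS -[X in (_ < X)%N]card_ord -cardsT; apply: proper_card.
    rewrite finset.properT; apply/eqP => NT.
    have /choice[z zP] i : exists z, dst x i z <= t n.
      have : i \in N n by rewrite NT finset.in_setT.
      by rewrite inE => /existsP.
    have [i] := sC x Cx [ffun i => z i]; rewrite ffunE ltNge => /negP; apply.
    exact: le_trans (zP i) (t_le n (leqnn n)).
  (* For the least k with #|N k| <= k, the inequalities k <= #|N k.-1| <= #|N k|
     are equalities: exactly k coordinates are near at the scale t k, strictly so
     since they are near at the previous scale. *)
  have [k Nk kmin] := ex_minnP (ex_intro (fun k => (#|N k| <= k)%N) n Nn).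
  have kn : (k <= n)%N by exact: kmin.
  have [cardN strict] : #|N k| = k /\ forall i, i \in N k -> exists z, dst x i z < t k.
    case: k Nk kmin kn => [|k] Nk kmin kn.
      have /cards0_eq N0 : #|N 0%N| = 0%N by apply/eqP; rewrite -leqn0.
      by rewrite N0 cards0; split=> // i; rewrite finset.in_set0.
    have kNk : (k < #|N k|)%N by rewrite ltnNge; apply/negP => /kmin; rewrite ltnn.
    have NE : N k = N k.+1.
      by apply/eqP; rewrite eqEcard NS (leq_trans Nk).
    split; first by apply/eqP; rewrite eqn_leq Nk -NE.
    move=> i; rewrite -NE inE => /existsP[z xz]; exists z.
    exact: le_lt_trans xz (t_lt k).
  have /choice[z zP] i :
      exists z : 'I_K.+1, cell (i \in N k) (a 0 i) h (t k) z (x 0 i).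
    case: (boolP (i \in N k)) => [/strict//|].
    rewrite inE negb_exists => /forallP; apply: cell_cover => //.
    by have := CB x Cx i; have := aP i; rewrite ltr_norml; lra.
  exists (N k, [ffun i => z i]) => //; split; rewrite /= cardN // => i.
  by rewrite ffunE.
- have [[y [Cy Vy]]|CV0] := pselect (C `&` V j !=set0); last first.
    by have [i _ _] := CU x0 Cx0; exists i => x CVx; case: CV0; exists x.
  have [i yU] := leb y Cy; exists i => x [_ Vx]; apply: yU; apply/rV_ballP => // k.
  exact: cell_diam (th _ Vy.1) (t0 _) (Vy.2 k) (Vx.2 k).
- rewrite subrK lez_nat; pose f (j : J) : 'I_n.+1 := inord #|j.1|.
  rewrite -[leqRHS]card_ord -(@card_in_image _ _ f) ?max_card //.
  move=> j j'; rewrite !inE => jx j'x fE; apply: (Vinj x) => //.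
  have := congr1 (@nat_of_ord _) fE; rewrite /f !inordK ?ltnS //.
    by case: j'x.
  by case: jx.
Unshelve. all: by end_near. Qed.

(** * Manifolds *)

Section Manifolds.
Context {R : realType} {M : metricType R}.

Lemma closure_ball_half (x : M) (e : R) :
  0 < e -> closure (ball x (e / 2)) `<=` ball x e.
Proof.
move=> e0 y ycl; have e2 : 0 < e / 2 by rewrite divr_gt0.
have [z [xz yz]] := ycl _ (nbhsx_ballx y (e / 2) e2).
by rewrite (splitr e); apply: ball_triangle xz _; exact: ball_sym.
Qed.

(** By locality of the dimension it suffices to treat the part of C in a small
    closed ball inside a chart, whose image in the Euclidean space is compact and
    has no interior because the chart is open. *)
Lemma nowhere_dense_dim_le n (C : set M) : locally_euclidean R n.+1 M ->
  compact C -> C^° = set0 -> covering_dim_le C (n.+1%:Z - 1).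
Proof.
move=> Mn Ccpt C0; have Ccl : closed C.
  by apply: compact_closed => //; exact: metric_hausdorff.
apply: covering_dim_le_local => // x Cx.
have [U [V [Uo Ux Vo [phi [psi [[UV phic phiK] [VU psic psiK]]]]]]] := Mn x.
have /nbhs_ballP[e /= e0 xeU] : nbhs x U by exact: open_nbhs_nbhs.
pose B := closure (ball x (e / 2)).
have BU : B `<=` U by apply: subset_trans xeU; exact: closure_ball_half.
exists B; split; first exact: closed_closure.
  by apply: filterS (@subset_closure _ _) _; apply: nbhsx_ballx; rewrite divr_gt0.
have CBU : C `&` B `<=` U by move=> y [_ /BU].
pose D := phi @` (C `&` B).
have Dcpt : compact D.
  apply: continuous_compact; first exact: continuous_subspaceW phic.
  by apply: compact_closedI => //; exact: closed_closure.
have phiI X : open X -> open (U `&` phi @^-1` X).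
  by move: X; apply/(continuous_inP _ Uo); rewrite -continuous_open_subspace.
have D0 : D^° = set0.
  rewrite -subset0 => p Dp.
  have [y [Cy By] yp] : D p by exact: interior_subset.
  suff : C^° y by rewrite C0.
  have /phiI Wo := open_interior D.
  have Wy : (U `&` phi @^-1` D^°) y by split; [exact: BU|rewrite /= yp].
  apply: filterS (open_nbhs_nbhs (conj Wo Wy)) => w [Uw /interior_subset].
  move=> [w' [Cw' Bw'] ww'].
  by rewrite -(phiK w) ?inE // -ww' phiK ?inE //; exact: BU.
have -> : C `&` B = psi @` D.
  apply/seteqP; split=> [y CBy|_ [_ [y CBy <-] <-]].
    by exists (phi y); [exists y|rewrite phiK // inE; exact: CBU].
  by rewrite phiK // inE; exact: CBU.
apply: (covering_dim_le_image Vo Uo VU psic phic psiK).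
  by move=> _ [y CBy <-]; exact/UV/CBU.
exact: covering_dim_le_nowhere_dense.
Qed.

(** The preimage of a small cube under a chart. *)
Lemma full_dim_compact_in_ball n (x : M) (r : R) : (0 < n)%N ->
  locally_euclidean R n M -> 0 < r ->
  exists C : set M, [/\ compact C, nontrivial_set C, C `<=` ball x r &
    covering_dim_gt C (n%:Z - 1)].
Proof.
move=> n0 Mn r0.
have [U [V [Uo Ux Vo [phi [psi [[UV phic phiK] [VU psic psiK]]]]]]] := Mn x.
pose c := phi x; have Vc : V c by exact: UV.
have cx : psi c = x by rewrite phiK ?inE.
have Oo : open (V `&` psi @^-1` (ball x r)^°).
  move: (open_interior (ball x r)); move: (_^°).
  by apply/(continuous_inP _ Vo); rewrite -continuous_open_subspace.
have Oc : (V `&` psi @^-1` (ball x r)^°) c.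
  by split=> //; rewrite /= cx; exact: nbhsx_ballx.
have /nbhs_ballP[e /= e0 ceO] := open_nbhs_nbhs (conj Oo Oc).
have e2 : 0 < e / 2 by rewrite divr_gt0.
have QO : cube c (e / 2) `<=` V `&` psi @^-1` (ball x r)^°.
  apply: subset_trans ceO => y Qy; apply/rV_ballP => // i.
  by rewrite distrC (le_lt_trans (Qy i)) // ltr_pdivrMr // ltr_pMr // ltr1n.
have QV : cube c (e / 2) `<=` V by move=> y /QO[].
exists (psi @` cube c (e / 2)); split.
- apply: continuous_compact; first exact: continuous_subspaceW psic.
  exact: cube_compact.
- pose c' : 'rV[R]_n := \row_i (c 0 i + e / 2).
  have Qc : cube c (e / 2) c by move=> i; rewrite subrr normr0 ltW.
  have Qc' : cube c (e / 2) c' by move=> i; rewrite mxE addrC addKr gtr0_norm.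
  exists (psi c), (psi c'); split; [by exists c|by exists c'|move=> cc'].
  have : c = c' by rewrite -(psiK c) ?cc' ?psiK ?inE //; exact: QV.
  by move=> /rowP/(_ (Ordinal n0)); rewrite mxE; lra.
- by move=> _ [y /QO[_ /interior_subset ?] <-].
- move=> /(covering_dim_le_image Uo Vo UV phic psic phiK) Cd.
  apply: (cube_dim_gt (c := c) e2).
  have -> : cube c (e / 2) = phi @` (psi @` cube c (e / 2)).
    apply/seteqP; split=> [y Qy|_ [_ [y Qy <-] <-]].
      by exists (psi y); [exists y|rewrite psiK // inE; exact: QV].
    by rewrite psiK // inE; exact: QV.
  by apply: Cd => _ [y /QV Vy <-]; exact: VU.
Qed.

Lemma compact_mdist_bounded : compact [set: M] ->
  exists B : R, forall x y : M, mdist x y <= B.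
Proof.
move=> Mcpt; have [[x0]|noM] := pselect (exists x : M, True); last first.
  by exists 0 => x; case: noM; exists x.
move/compact_near_coveringP : Mcpt => Mcpt.
have : \forall B \near +oo, [set: M] `<=` [set x | mdist x0 x < B].
  apply: Mcpt => x _.
  exists (ball x 1, [set B | mdist x0 x + 1 < B]) => /=.
    by split; [exact: nbhsx_ballx|exact/nbhs_pinfty_gt/num_real].
  move=> [y B] [/=]; rewrite ballEmdist /= => xy; apply: le_lt_trans.
  by rewrite (le_trans (metric_triangle x0 x y)) // lerD2l ltW.
move=> bounded; near (+oo : set_system R) => B; exists (B + B) => x y.
have bB z : mdist x0 z < B by apply: (near bounded B).
rewrite (le_trans (metric_triangle x x0 y)) // lerD ?ltW //.
by rewrite metric_sym.
Unshelve. all: by end_near. Qed.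

Lemma mdist_le_diam (C : set M) x y : compact [set: M] -> C x -> C y ->
  mdist x y <= diam C.
Proof.
move=> /compact_mdist_bounded[B MB] Cx Cy; apply: ub_le_sup.
  by exists B => _ [p _ <-].
by exists (x, y).
Qed.

Lemma diam_le (C : set M) (B : R) : C !=set0 ->
  (forall x y, C x -> C y -> mdist x y <= B) -> diam C <= B.
Proof.
move=> [x Cx] CB; apply: ge_sup; first by exists (mdist x x); exists (x, x).
by move=> _ [[y z] [/= Cy Cz] <-]; exact: CB.
Qed.

End Manifolds.

Theorem proposition2p11 (R : realType) (n : nat) (M : metricType R)
    (n_gt0 : (0 < n)%N) (M_compact : compact [set: M])
    (M_manifold : locally_euclidean R n M) (f : homeo M) :
  partially_expansive f (n%:Z - 1) <-> sensitive f.
Proof.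
split=> [[eps eps0 fexp]|[rho rho0 fsens]].
  exists (eps / 4) => [|x r r0]; first by rewrite divr_gt0.
  apply: contrapT => /forallNP stable.
  have close y k : ball x r y ->
      mdist (homeo_iter f k y) (homeo_iter f k x) <= eps / 4.
    by move=> xy; rewrite leNgt; apply/negP => far; apply: (stable y); exists k.
  have [C [Ccpt Cnt Cx Cdim]] := full_dim_compact_in_ball x n_gt0 M_manifold r0.
  have [k] := fexp C Ccpt Cnt Cdim.
  suff : diam (homeo_iter f k @` C) <= eps / 4 + eps / 4 by lra.
  apply: diam_le.
    by have [y [_ [Cy _ _]]] := Cnt; exists (homeo_iter f k y); exists y.
  move=> _ _ [y /Cx/(close _ k) yx <-] [z /Cx/(close _ k) zx <-].
  rewrite (le_trans (metric_triangle _ (homeo_iter f k x) _)) // lerD //.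
  by rewrite metric_sym.
exists rho => // C Ccpt _ Cdim.
have /set0P[x Cx] : C^° != set0.
  apply/eqP => C0; apply: Cdim; case: n n_gt0 M_manifold => // m _ Mm.
  exact: nowhere_dense_dim_le.
have /nbhs_ballP[r /= r0 xrC] := Cx.
have [y [k [xy far]]] := fsens x r r0; exists k; apply/ltW/(lt_le_trans far).
by apply: mdist_le_diam => //; [exists y|exists x] => //; apply: xrC => //; exact: ballxx.
Qed.
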